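(* Let $\Phi$ be a root system of type $B_n$, $C_n$ or $D_n$. Put $\delta_\Phi=1/2$ if $\Phi=B_n$, $\delta_\Phi=1$ if $\Phi=C_n$, and $\delta_\Phi=0$ if $\Phi=D_n$, and let $$\rho_\Phi=(0,1,\dots,n-1)+\delta_\Phi(1,1,\dots,1)\in\mathbb{R}^n.$$ Then $x\in\mathbb{R}^n$ is a mean score sequence of a random Coxeter tournament on the complete $\Phi$-graph $\mathcal{K}_\Phi$ if and only if $|x|=(|x_1|,\dots,|x_n|)$ is weakly sub-majorized by $\rho_\Phi$.
   Context: Write $[n]=\{1,\dots,n\}$. For $x,y\in\mathbb{R}^n$, $x$ is weakly sub-majorized by $y$ (written $x\preceq_w y$) if $\sum_{i=1}^k (x^\downarrow)_i\le\sum_{i=1}^k(y^\downarrow)_i$ for all $k\in[n]$, where $z^\downarrow$ denotes the non-increasing rearrangement of $z$. The complete $\Phi$-graph $\mathcal{K}_\Phi$ on vertex set $[n]$ is the signed graph with all negative edges $E^-=\binom{[n]}{2}$ and all positive edges $E^+=\binom{[n]}{2}$; in addition, if $\Phi=B_n$ it has half-edges $H=[n]$ and no loops ($L=\emptyset$); if $\Phi=C_n$ it has loops $L=[n]$ and no half-edges ($H=\emptyset$); if $\Phi=D_n$ then $H=L=\emptyset$. A random Coxeter tournament on $\mathcal{K}_\Phi$ is a collection of numbers in $[0,1]$: $p_{ij}^-=1-p_{ji}^-$ for each negative edge $ij\in E^-$; $p_{ij}^+=p_{ji}^+$ for each positive edge $ij\in E^+$; $p_i^h$ for each half-edge $i\in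 H$; $p_i^\ell$ for each loop $i\in L$. Its mean score sequence is the vector $x\in\mathbb{R}^n$ with coordinates $$x_i=\sum_{j\ne i}(p_{ij}^--\tfrac12)+\sum_{j\ne i}(p_{ij}^+-\tfrac12)+\mathbf{1}_{i\in H}(p_i^h-\tfrac12)+\mathbf{1}_{i\in L}\,2(p_i^\ell-\tfrac12).$$ *)

(* Defs.v *)
From mathcomp Require Import all_boot all_order all_algebra.
From mathcomp Require Import reals.

Set Implicit Arguments.
Unset Strict Implicit.
Unset Printing Implicit Defensive.

Import Order.TTheory GRing.Theory Num.Theory.

Local Open Scope ring_scope.

Inductive root_type := TypeB | TypeC | TypeD.

(* An edge {i, j} is a two-element set of vertices. *)
Record signed_graph (n : nat) := SignedGraph {
  neg_edges : {set {set 'I_n}};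
  pos_edges : {set {set 'I_n}};
  half_edges : {set 'I_n};
  loops : {set 'I_n}
}.

Definition complete_graph (Phi : root_type) (n : nat) : signed_graph n :=
  let all_pairs := [set e : {set 'I_n} | #|e| == 2%N] in
  {| neg_edges := all_pairs;
     pos_edges := all_pairs;
     half_edges := if Phi is TypeB then setT else set0;
     loops := if Phi is TypeC then setT else set0 |}.

(* The probabilities are total functions, constrained only on actual edges,   *)
(* half-edges and loops; mean_score never depends on the remaining values.    *)
Record coxeter_tournament (R : realType) (Phi : root_type) (n : nat) :=
  CoxeterTournament {
    p_neg : 'I_n -> 'I_n -> R;
    p_pos : 'I_n -> 'I_n -> R;
    p_half : 'I_n -> R;
    p_loop : 'I_n -> R;
    p_neg_itv : forall i j, [set i; j] \in neg_edges (complete_graph Phi n) ->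
      0 <= p_neg i j <= 1;
    p_neg_compl : forall i j, [set i; j] \in neg_edges (complete_graph Phi n) ->
      p_neg i j = 1 - p_neg j i;
    p_pos_itv : forall i j, [set i; j] \in pos_edges (complete_graph Phi n) ->
      0 <= p_pos i j <= 1;
    p_pos_sym : forall i j, [set i; j] \in pos_edges (complete_graph Phi n) ->
      p_pos i j = p_pos j i;
    p_half_itv : forall i, i \in half_edges (complete_graph Phi n) ->
      0 <= p_half i <= 1;
    p_loop_itv : forall i, i \in loops (complete_graph Phi n) ->
      0 <= p_loop i <= 1
  }.

Definition mean_score (R : realType) (Phi : root_type) (n : nat)
    (T : coxeter_tournament R Phi n) : 'rV[R]_n :=
  \row_(i < n)
    (\sum_(j < n | j != i) (p_neg T i j - 2^-1)
     + \sum_(j < n | j != i) (p_pos T i j - 2^-1)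
     + (i \in half_edges (complete_graph Phi n))%:R * (p_half T i - 2^-1)
     + (i \in loops (complete_graph Phi n))%:R * (2 * (p_loop T i - 2^-1))).

Definition nonincr_rearr (R : realType) (n : nat) (z : 'rV[R]_n) : 'rV[R]_n :=
  \row_(i < n) (sort >=%R [seq z ord0 j | j : 'I_n])`_i.

Definition weakly_submajorized (R : realType) (n : nat) (x y : 'rV[R]_n) :=
  forall k : nat, (1 <= k <= n)%N ->
    \sum_(i < n | (i < k)%N) nonincr_rearr x ord0 i
      <= \sum_(i < n | (i < k)%N) nonincr_rearr y ord0 i.

(* Entrywise; `|x| on row vectors would denote a norm. *)
Definition abs_vec (R : realType) (n : nat) (x : 'rV[R]_n) : 'rV[R]_n :=
  map_mx (fun t : R => `|t|) x.

Definition delta (R : realType) (Phi : root_type) : R :=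
  match Phi with TypeB => 2^-1 | TypeC => 1 | TypeD => 0 end.

Definition rho (R : realType) (Phi : root_type) (n : nat) : 'rV[R]_n :=
  (\row_(i < n) i%:R) + delta R Phi *: const_mx 1.

(* Main.v *)
Require Import Defs.
From mathcomp Require Import all_boot all_order all_algebra.
From mathcomp Require Import reals.
From mathcomp Require Import perm.
From mathcomp Require Import ring lra.

(** Only the net amount [c i j] that vertex [i] receives from its positive and
    negative edges to [j] matters.  A positive and a negative edge contribute
    [a i j + b i j] to [i] and [b i j - a i j] to [j], with [a] and [b] ranging
    independently over [[-1/2, 1/2]], so the pairs [(c i j, c j i)] that occur
    are exactly those with [`|c i j| + `|c j i| <= 1].  In the same way a
    half-edge or a loop contributes an arbitrary number of absolute value at
    most [delta].  The score vectors are therefore the row sums of such arrays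
    ([realizable], [mean_scoreP]), a description in which all the symmetries
    are visible: the set is convex, invariant under permutations
    ([realizable_perm]), and solid, since a row may be multiplied by any number
    in [[-1, 1]] ([realizable_solid]).

    Necessity: a pair of vertices hands out at most one unit, so the first [k]
    vertices together obtain at most one unit per pair meeting them, plus
    [k * delta] ([realizable_prefix_le]).  This is the sum of the [k] largest
    entries of [rho].

    Sufficiency: the decreasing rearrangement of [rho] is realized by letting
    the smaller index take everything in every pair ([realizable_staircase]).
    Any vector weakly sub-majorized by it is reached by finitely many Robin
    Hood transfers, each of which is a convex combination of a vector and a
    transposed copy of it, followed by a coordinatewise shrinking
    ([realizable_majorized]). *)

Set Implicit Arguments.
Unset Strict Implicit.
Unset Printing Implicit Defensive.

Import Order.TTheory GRing.Theory Num.Theory.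

Local Open Scope ring_scope.

(** * Decreasing rearrangements *)

Lemma nth_image_ord (R : nmodType) n (F : 'I_n -> R) (i : 'I_n) :
  [seq F j | j : 'I_n]`_i = F i.
Proof. by rewrite (nth_map i) ?size_enum_ord ?nth_ord_enum. Qed.

Section Rearrangement.
Variables (R : realType) (n : nat).
Implicit Type z : 'rV[R]_n.

Let ge_R_total : total (>=%R : rel R).
Proof. by move=> a b; exact: le_total. Qed.

Let ge_R_trans : transitive (>=%R : rel R).
Proof. by move=> b a c /= ba cb; exact: le_trans cb ba. Qed.

Lemma size_sorted_entries z :
  size (sort >=%R [seq z ord0 j | j : 'I_n]) = n.
Proof. by rewrite size_sort size_image card_ord. Qed.

Lemma nonincr_rearr_antitone z (i j : 'I_n) :
  (i <= j)%N -> nonincr_rearr z ord0 j <= nonincr_rearr z ord0 i.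
Proof.
move=> ij; rewrite !mxE.
have st := sort_sorted ge_R_total [seq z ord0 j | j : 'I_n].
apply: (sorted_leq_nth ge_R_trans _ 0 st) => //.
- by move=> a; exact: lexx.
- by rewrite inE size_sorted_entries.
- by rewrite inE size_sorted_entries.
Qed.

Lemma nonincr_rearr_perm z :
  exists s : 'S_n, forall i, nonincr_rearr z ord0 i = z ord0 (s i).
Proof.
have Hs : size (sort >=%R [seq z ord0 j | j : 'I_n]) == n.
  by rewrite size_sorted_entries.
have : perm_eq (Tuple Hs) [tuple z ord0 i | i < n].
  rewrite /= (perm_trans (permEl (perm_sort _ _))) //=.
case/tuple_permP => s es; exists s => i; rewrite mxE.
have -> : sort >=%R [seq z ord0 j | j : 'I_n] = tval (Tuple Hs) by [].
by rewrite es -tnth_nth !tnth_mktuple.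
Qed.

Lemma nonincr_rearr_uniq z (s : 'S_n) :
  (forall i j : 'I_n, (i <= j)%N -> z ord0 (s j) <= z ord0 (s i)) ->
  forall i, nonincr_rearr z ord0 i = z ord0 (s i).
Proof.
move=> zs i; rewrite mxE.
have -> : sort >=%R [seq z ord0 j | j : 'I_n] = [seq z ord0 (s j) | j : 'I_n].
  apply: (sorted_eq ge_R_trans).
  - by move=> a b /andP[/= ba ab]; apply/le_anti/andP.
  - exact: sort_sorted.
  - apply/(sortedP 0) => k; rewrite size_image card_ord => kn'.
    have kn := ltnW kn'.
    have := zs (Ordinal kn) (Ordinal kn') (leqnSn k).
    have zsE := nth_image_ord (fun j => z ord0 (s j)).
    by have /= <- := zsE (Ordinal kn); have /= <- := zsE (Ordinal kn').
  - rewrite perm_sort.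
    have -> : [seq z ord0 (s j) | j : 'I_n]
            = [seq z ord0 j | j <- [seq s j | j : 'I_n]] by rewrite -map_comp.
    apply: perm_map; apply: uniq_perm.
    + exact: enum_uniq.
    + by rewrite map_inj_uniq ?enum_uniq //; exact: perm_inj.
    + move=> j; rewrite mem_enum; apply/esym/mapP.
      by exists ((s^-1)%g j); rewrite ?mem_enum ?permKV.
exact: nth_image_ord.
Qed.

End Rearrangement.

(** * Net contributions *)

Section Realizable.
Variables (R : realFieldType) (n : nat) (dlt : R).
Implicit Types x y : 'I_n -> R.

(** Here [c i j] is what [i] receives in total from the two edges between [i]
    and [j], and [h i] what it receives from its half-edge or loop. *)
Definition realizable x :=
  exists (c : 'I_n -> 'I_n -> R) (h : 'I_n -> R),
  [/\ forall i j, i != j -> `|c i j| + `|c j i| <= 1,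
      forall i, `|h i| <= dlt &
      forall i, x i = \sum_(j < n | j != i) c i j + h i].

Lemma realizable_perm (s : 'S_n) x :
  realizable x -> realizable (fun i => x (s i)).
Proof.
case=> c [h [cP hP xE]].
exists (fun i j => c (s i) (s j)), (fun i => h (s i)); split=> //.
  by move=> i j ij; apply: cP; rewrite (inj_eq perm_inj).
move=> i; rewrite xE (reindex_inj (@perm_inj _ s)) /=; congr (_ + _).
by apply: eq_bigl => j; rewrite (inj_eq perm_inj).
Qed.

(** The row of [c] and the entry of [h] at [i] are multiplied by the ratio
    [x i / y i], of absolute value at most one.  If [y i = 0] then [x i = 0]
    and the ratio is [0] by convention, which is the right factor. *)
Lemma realizable_solid x y :
  (forall i, `|x i| <= `|y i|) -> realizable y -> realizable x.
Proof.
move=> xy [c [h [cP hP yE]]].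
have t1 i : `|x i / y i| <= 1.
  rewrite normrM normfV; have [->|y0] := eqVneq (y i) 0.
    by rewrite normr0 invr0 mulr0.
  by rewrite ler_pdivrMr ?normr_gt0 // mul1r.
have shrink i a : `|x i / y i * a| <= `|a|.
  by rewrite normrM ler_piMl.
exists (fun i j => x i / y i * c i j), (fun i => x i / y i * h i); split.
- move=> i j ij; apply: le_trans (cP i j ij).
  by apply: lerD; exact: shrink.
- by move=> i; apply: le_trans (hP i); exact: shrink.
- move=> i; rewrite -mulr_sumr -mulrDr -yE.
  have [y0|y0] := eqVneq (y i) 0; last by rewrite divfK.
  by have := xy i; rewrite y0 normr0 mulr0 normr_le0 => /eqP.
Qed.

Lemma realizable_convex (t : R) x y : 0 <= t <= 1 ->
  realizable x -> realizable y ->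
  realizable (fun i => (1 - t) * x i + t * y i).
Proof.
move=> /andP[t0 t1] [c [h [cP hP xE]]] [c' [h' [cP' hP' yE]]].
have t1' : 0 <= 1 - t by rewrite subr_ge0.
have tri (a b : R) : `|(1 - t) * a + t * b| <= (1 - t) * `|a| + t * `|b|.
  by apply: le_trans (ler_normD _ _) _; rewrite !normrM (ger0_norm t0) (ger0_norm t1').
exists (fun i j => (1 - t) * c i j + t * c' i j),
       (fun i => (1 - t) * h i + t * h' i); split.
- move=> i j ij /=.
  have := lerD (tri (c i j) (c' i j)) (tri (c j i) (c' j i)).
  have := ler_wpM2l t1' (cP i j ij); have := ler_wpM2l t0 (cP' i j ij); lra.
- move=> i /=; have := tri (h i) (h' i).
  have := ler_wpM2l t1' (hP i); have := ler_wpM2l t0 (hP' i); lra.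
- by move=> i; rewrite big_split -!mulr_sumr xE yE /=; ring.
Qed.

(** Moving [d] from [j] to [k] is the convex combination of [y] and of [y]
    with entries [j] and [k] exchanged, with weight [d / (y j - y k)]. *)
Lemma realizable_transfer y (j k : 'I_n) (d : R) :
  0 <= d -> d <= y j - y k -> y k < y j -> realizable y ->
  realizable (fun i => y i - d *+ (i == j) + d *+ (i == k)).
Proof.
move=> d0 dy kj yP.
have D0 : 0 < y j - y k by rewrite subr_gt0.
have tP : 0 <= d / (y j - y k) <= 1.
  by rewrite divr_ge0 ?(ltW D0) //= ler_pdivrMr // mul1r.
apply: realizable_solid (realizable_convex tP yP (realizable_perm (tperm j k) yP)).
move=> i; rewrite le_eqVlt; apply/orP; left; apply/eqP; congr `|_|.
have jk : j != k by apply: contraTneq kj => ->; rewrite ltxx.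
have Dn : y j - y k != 0 by rewrite gt_eqF.
case: tpermP => [->|->|/eqP ij /eqP ik].
- by rewrite eqxx (negbTE jk) mulr1n mulr0n; field.
- by rewrite eqxx eq_sym (negbTE jk) mulr1n mulr0n; field.
- by rewrite (negbTE ij) (negbTE ik) !mulr0n; field.
Qed.

(** * Weak majorization and Robin Hood transfers *)

(** Let [k] be the first index where [x] exceeds [y].  By the prefix sums up to
    [k], some [j < k] has [x j < y j]; since [x] is nonincreasing,
    [y k < x k <= x j < y j], so that [j] can give to [k] until one of the two
    entries agrees with [x].  Prefixes ending between [j] and [k] still dominate
    those of [x]: as [x <= y] before [k], their surplus was at least
    [y j - x j], and they lose no more than that.  Each transfer lowers the
    number of disagreements; when no such [k] exists, [x <= y] and solidity
    concludes.  A transfer may leave the entries of [y] out of order, which is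
    why only [x] is sorted here. *)
Lemma realizable_majorized x y :
  (forall i, 0 <= x i) ->
  (forall i j : 'I_n, (i <= j)%N -> x j <= x i) ->
  (forall m, (1 <= m <= n)%N ->
     \sum_(i < n | (i < m)%N) x i <= \sum_(i < n | (i < m)%N) y i) ->
  realizable y -> realizable x.
Proof.
move=> x0 xdec.
have [N] := ubnP #|[pred i | x i != y i]|.
elim: N y => // N IH y cardN dom yP.
have [[k yk kmin]|xley] :
    (exists2 k : 'I_n, y k < x k & forall i : 'I_n, (i < k)%N -> x i <= y i)
    \/ (forall i, x i <= y i).
- have [k0 yk0|no] := pickP [pred k | y k < x k]; last first.
    by right=> i; rewrite leNgt; have /= -> := no i.
  left; case: (arg_minnP (fun k : 'I_n => k : nat) yk0) => k yk kmin.
  exists k => // i ik; rewrite leNgt; apply/negP => /kmin.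
  by rewrite leqNgt ik.
- have [j jk xj] : exists2 j : 'I_n, (j < k)%N & x j < y j.
    have [j /andP[jk xj]|no] := pickP [pred j : 'I_n | (j < k)%N && (x j < y j)].
      by exists j.
    have k1n : (1 <= k.+1 <= n)%N by rewrite /= ltn_ord.
    have := dom _ k1n; rewrite leNgt => /negP[].
    rewrite [ltLHS](bigD1 k) //= [ltRHS](bigD1 k) //=.
    apply: ltr_leD => //; apply: ler_sum => i /andP[ik ink].
    rewrite leNgt; have /negbT := no i; rewrite /= negb_and.
    by rewrite ltn_neqAle -ltnS ik ink.
  have jnk : j != k by rewrite neq_ltn jk.
  pose d := Num.min (y j - x j) (x k - y k).
  have d0 : 0 < d by rewrite lt_min !subr_gt0 xj.
  have dj : d <= y j - x j by rewrite ge_min lexx.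
  have dk : d <= x k - y k by rewrite ge_min lexx orbT.
  have xkj := xdec _ _ (ltnW jk).
  pose y' i := y i - d *+ (i == j) + d *+ (i == k).
  have y'P : realizable y' by apply: realizable_transfer yP; lra.
  have y'E i : i != j -> i != k -> y' i = y i.
    by move=> /negbTE ij /negbTE ik; rewrite /y' ij ik subr0 addr0.
  have y'j : y' j = y j - d by rewrite /y' eqxx (negbTE jnk) addr0.
  have y'k : y' k = y k + d.
    by rewrite /y' eqxx [k == j]eq_sym (negbTE jnk) subr0.
  have sum_y' (m : nat) : \sum_(i < n | (i < m)%N) y' i =
      \sum_(i < n | (i < m)%N) y i - d *+ (j < m)%N + d *+ (k < m)%N.
    have pick (a : 'I_n) :
        \sum_(i < n | (i < m)%N) d *+ (i == a) = d *+ (a < m)%N.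
      rewrite big_mkcond (bigD1 a) //= eqxx big1 ?addr0; first by case: ifP.
      by move=> i /negbTE ->; case: ifP.
    by rewrite big_split sumrB /= !pick.
  apply: (IH y') => // [|m mn].
  - rewrite -ltnS; apply: leq_trans cardN; rewrite ltnS; apply: proper_card.
    apply/properP; split.
      apply/subsetP => i; rewrite !inE; apply: contraNneq => xyi.
      have ij : i != j by apply: contraTneq xj => <-; rewrite xyi ltxx.
      have ik : i != k by apply: contraTneq yk => <-; rewrite xyi ltxx.
      by rewrite y'E // xyi.
    (* The choice of [d] brings one of the two entries to its target. *)
    have [dE|dE] : d = y j - x j \/ d = x k - y k.
      by rewrite /d minEle; case: ifP; [left|right].
    + exists j; first by rewrite inE lt_eqF.
      by rewrite inE /= negbK y'j dE; apply/eqP; ring.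
    + exists k; first by rewrite inE gt_eqF.
      by rewrite inE /= negbK y'k dE; apply/eqP; ring.
  - rewrite sum_y'; have [km|mk] := ltnP k m.
      by rewrite (ltn_trans jk km) subrK dom.
    rewrite addr0; have [jm|mj] := ltnP j m; last by rewrite subr0 dom.
    rewrite mulr1n [leLHS](bigD1 j) //= [in leRHS](bigD1 j) //=.
    have : \sum_(i < n | (i < m)%N && (i != j)) x i
        <= \sum_(i < n | (i < m)%N && (i != j)) y i.
      by apply: ler_sum => i /andP[im _]; apply: kmin; apply: leq_trans im mk.
    lra.
- apply: realizable_solid yP => i.
  by rewrite !ger0_norm // (le_trans (x0 i)).
Qed.

Lemma sum1_ord_gt (i : 'I_n) :
  \sum_(j < n | (i < j)%N) (1 : R) = (n - i.+1)%:R.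
Proof.
transitivity (\sum_(i.+1 <= j < n) (1 : R)); last by rewrite sumr_const_nat.
by rewrite big_geq_mkord.
Qed.

(** In each pair the smaller index receives everything. *)
Lemma realizable_staircase :
  0 <= dlt -> realizable (fun i => (n - i.+1)%:R + dlt).
Proof.
move=> dlt0; exists (fun i j => (i < j)%N%:R), (fun=> dlt); split.
- by move=> i j; rewrite neq_ltn !ger0_norm //; case: ltngtP; rewrite ?addr0 ?add0r.
- by move=> i; rewrite ger0_norm.
- move=> i; congr (_ + _); rewrite -sum1_ord_gt big_mkcond (bigD1 i) //=.
  by rewrite ltnn add0r; apply: eq_bigr => j _; case: ifP.
Qed.

(** * Prefix sums of realizable vectors *)

(** For [i < k], split the contributions [`|c i j|] into those with [i < j] and
    those with [j < i].  A pair of the second kind lies inside the prefix, so it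
    can be charged to its smaller vertex instead.  Each [i < k] is then charged
    at most one unit for each of the [n - i.+1] larger vertices. *)
Lemma realizable_prefix_le x (k : nat) : realizable x ->
  \sum_(i < n | (i < k)%N) `|x i|
    <= \sum_(i < n | (i < k)%N) ((n - i.+1)%:R + dlt).
Proof.
case=> c [h [cP hP xE]].
(* What [i] receives from larger vertices, what it receives from smaller ones,
   and what the larger vertices receive from it. *)
pose S (i : 'I_n) : R := \sum_(j < n | (i < j)%N) `|c i j|.
pose D (i : 'I_n) : R := \sum_(j < n | (j < i)%N) `|c i j|.
pose U (i : 'I_n) : R := \sum_(j < n | (i < j)%N) `|c j i|.
have xSD i : `|x i| <= S i + D i + dlt.
  rewrite xE; apply: le_trans (ler_normD _ _) _; apply: lerD (hP i).
  apply: le_trans (ler_norm_sum _ _ _) _.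
  rewrite (bigID (fun j : 'I_n => (i < j)%N)) /=.
  rewrite le_eqVlt; apply/orP; left; apply/eqP; congr (_ + _); apply: eq_bigl => j.
    by rewrite neq_ltn; case: ltngtP.
  by rewrite neq_ltn; case: ltngtP.
have SU i : S i + U i <= (n - i.+1)%:R.
  rewrite -sum1_ord_gt -big_split; apply: ler_sum => j ij /=.
  by apply: cP; rewrite neq_ltn ij.
have DU : \sum_(i < n | (i < k)%N) D i <= \sum_(i < n | (i < k)%N) U i.
  rewrite /D (exchange_big_dep (fun j : 'I_n => (j < k)%N)) /=; last first.
    by move=> i j ik ji; apply: ltn_trans ji ik.
  apply: ler_sum => i ik; rewrite /U [leRHS](bigID (fun j : 'I_n => (j < k)%N)) /=.
  under eq_bigl do rewrite andbC.
  by rewrite lerDl sumr_ge0.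
apply: le_trans (_ : \sum_(i < n | (i < k)%N) (S i + D i + dlt) <= _).
  by apply: ler_sum => i _; exact: xSD.
have : \sum_(i < n | (i < k)%N) (S i + U i)
    <= \sum_(i < n | (i < k)%N) (n - i.+1)%:R.
  by apply: ler_sum => i _; exact: SU.
rewrite !big_split /=; lra.
Qed.

End Realizable.

(** * Coxeter tournaments *)

Section Tournaments.
Variables (R : realType) (n : nat) (Phi : root_type).

Lemma delta_ge0 : 0 <= delta R Phi.
Proof. by case: Phi => /=; rewrite ?invr_ge0. Qed.

Lemma mem_neg_edges (i j : 'I_n) :
  ([set i; j] \in neg_edges (complete_graph Phi n)) = (i != j).
Proof. by rewrite inE cards2; case: (i != j). Qed.

Lemma mem_pos_edges (i j : 'I_n) :
  ([set i; j] \in pos_edges (complete_graph Phi n)) = (i != j).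
Proof. exact: mem_neg_edges. Qed.

Lemma realizable_mean_score (T : coxeter_tournament R Phi n) :
  realizable (delta R Phi) (fun i => mean_score T ord0 i).
Proof.
case: T => pn pp ph pl pnI pnC ppI ppS phI plI.
exists (fun i j => pn i j - 2^-1 + (pp i j - 2^-1)),
  (fun i => (i \in half_edges (complete_graph Phi n))%:R * (ph i - 2^-1)
          + (i \in loops (complete_graph Phi n))%:R * (2 * (pl i - 2^-1))).
split.
- move=> i j ij /=; have ij' := ij; rewrite -mem_neg_edges in ij'.
  have /andP[a0 a1] := pnI i j ij'; have /andP[b0 b1] := ppI i j ij'.
  have := pnC i j ij'; have := ppS i j ij' => bE aE.
  have -> : pn j i = 1 - pn i j by lra.
  rewrite -bE.
  by case: (ler0P (pn i j - 2^-1 + (pp i j - 2^-1)));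
     case: (ler0P (1 - pn i j - 2^-1 + (pp i j - 2^-1))); lra.
- move=> i; move: (phI i) (plI i).
  case: Phi => /=; rewrite !inE ?mul0r ?mul1r ?addr0 ?add0r => hI lI.
  + have /andP[? ?] := hI isT; rewrite ler_norml; apply/andP; split; lra.
  + have /andP[? ?] := lI isT; rewrite ler_norml; apply/andP; split; lra.
  + by rewrite normr0.
- by move=> i; rewrite mxE [in RHS]big_split /= !addrA.
Qed.

(** The net contributions of the negative and of the positive edge [{i, j}] to
    [i] are half the difference and half the sum of [c i j] and [c j i]; both
    are at most [1/2] in absolute value exactly when
    [`|c i j| + `|c j i| <= 1]. *)
Lemma realizable_tournament (x : 'rV[R]_n) :
  realizable (delta R Phi) (fun i => x ord0 i) ->
  exists T : coxeter_tournament R Phi n, mean_score T = x.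
Proof.
case=> c [h [cP hP xE]].
pose pn i j := 2^-1 + (c i j - c j i) / 2.
pose pp i j := 2^-1 + (c i j + c j i) / 2.
pose ph i := 2^-1 + h i.
pose pl i := 2^-1 + h i / 2.
have cij (i j : 'I_n) : i != j ->
    [/\ -1 <= c i j - c j i, c i j - c j i <= 1,
       -1 <= c i j + c j i & c i j + c j i <= 1].
  move=> /cP; have := ler_norm (c i j); have := ler_norm (c j i).
  have := ler_norm (- c i j); have := ler_norm (- c j i); rewrite !normrN.
  by move=> *; split; lra.
have pnI i j : [set i; j] \in neg_edges (complete_graph Phi n) -> 0 <= pn i j <= 1.
  by rewrite mem_neg_edges /pn => /cij[? ? ? ?]; apply/andP; split; lra.
have pnC i j : [set i; j] \in neg_edges (complete_graph Phi n) ->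
    pn i j = 1 - pn j i.
  by move=> _; rewrite /pn; field.
have ppI i j : [set i; j] \in pos_edges (complete_graph Phi n) -> 0 <= pp i j <= 1.
  by rewrite mem_pos_edges /pp => /cij[? ? ? ?]; apply/andP; split; lra.
have ppS i j : [set i; j] \in pos_edges (complete_graph Phi n) -> pp i j = pp j i.
  by move=> _; rewrite /pp [c i j + _]addrC.
have phI i : i \in half_edges (complete_graph Phi n) -> 0 <= ph i <= 1.
  have := hP i; rewrite /ph ler_norml => /andP[].
  case: Phi => /=; rewrite !inE // => ? ? _; apply/andP; split; lra.
have plI i : i \in loops (complete_graph Phi n) -> 0 <= pl i <= 1.
  have := hP i; rewrite /pl ler_norml => /andP[].
  case: Phi => /=; rewrite !inE // => ? ? _; apply/andP; split; lra.
exists (CoxeterTournament pnI pnC ppI ppS phI plI).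
apply/rowP => i; rewrite mxE /= xE -big_split /= -addrA; congr (_ + _).
  by apply: eq_bigr => j _; rewrite /pn /pp; field.
have := hP i; rewrite /ph /pl.
case: Phi => /=; rewrite !inE ?mul0r ?mul1r ?addr0 ?add0r.
- by move=> _; ring.
- by move=> _; field.
- by rewrite normr_le0 => /eqP.
Qed.

Lemma mean_scoreP (x : 'rV[R]_n) :
  (exists T : coxeter_tournament R Phi n, mean_score T = x) <->
  realizable (delta R Phi) (fun i => x ord0 i).
Proof.
split; last exact: realizable_tournament.
by case=> T <-; exact: realizable_mean_score.
Qed.

Lemma nonincr_rearr_rho (i : 'I_n) :
  nonincr_rearr (rho R Phi n) ord0 i = (n - i.+1)%:R + delta R Phi.
Proof.
rewrite (@nonincr_rearr_uniq _ _ _ (perm rev_ord_inj)).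
  by rewrite permE !mxE mulr1.
move=> a b ab; rewrite !permE !mxE lerD2r ler_nat /=.
by rewrite leq_sub2l.
Qed.

(** The decreasing rearrangement of [|x|] permutes the entries of [|x|], so by
    symmetry and solidity it is realizable exactly when [x] is. *)
Lemma realizable_rearr (x : 'rV[R]_n) :
  realizable (delta R Phi) (fun i => nonincr_rearr (abs_vec x) ord0 i) <->
  realizable (delta R Phi) (fun i => x ord0 i).
Proof.
have [s sE] := nonincr_rearr_perm (abs_vec x).
split=> [/(realizable_perm s^-1)|/(realizable_perm s)];
  apply: realizable_solid => i; rewrite sE mxE ?permKV normr_id //.
Qed.

End Tournaments.

Theorem theorem3p3 (R : realType) (n : nat) (Phi : root_type) (x : 'rV[R]_n) :
  (exists T : coxeter_tournament R Phi n, mean_score T = x) <->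
  weakly_submajorized (abs_vec x) (rho R Phi n).
Proof.
have rearr0 i : 0 <= nonincr_rearr (abs_vec x) ord0 i.
  by have [s ->] := nonincr_rearr_perm (abs_vec x); rewrite mxE.
have rhoE k : \sum_(i < n | (i < k)%N) nonincr_rearr (rho R Phi n) ord0 i
            = \sum_(i < n | (i < k)%N) ((n - i.+1)%:R + delta R Phi).
  by apply: eq_bigr => i _; exact: nonincr_rearr_rho.
rewrite mean_scoreP -realizable_rearr; split=> [xP k _|xrho].
- rewrite rhoE; apply: le_trans (realizable_prefix_le k xP).
  by apply: ler_sum => i _; exact: ler_norm.
- apply: realizable_majorized (realizable_staircase n (delta_ge0 R Phi)) => //.
  + exact: nonincr_rearr_antitone.
  + by move=> m mn; rewrite -rhoE; exact: xrho.
Qed.
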